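(* Let $\beta\in\mathbb{N}$, $\beta\ge 2$, and let a function $g\in BV_0^{\beta-1}$ (an admissible weight function of order $\beta$) be given. Furthermore, let $N\in 2\mathbb{N}$, $N\ge 2\beta$, and the damping factors $$\hat w_k=\frac{g\left(\frac{k}{N}\right)+g\left(\frac{k+1}{N}\right)}{2\|g\|_{1,N}},\qquad k=-\frac N2,\dots,\frac N2-1,$$ be given. Then the kernel $K_N(x)=\sum_{k=-N/2}^{N/2-1}\hat w_k\,e^{2\pi i kx}$ fulfils, for $x\in[-\frac12,\frac12]\setminus\{0\}$, $$|K_N(x)|\le \frac{(2^{\beta}-1)\,\zeta(\beta)\,|g^{(\beta-1)}|_V}{2^{\beta-1}(2\pi)^{\beta}-\zeta(\beta)\,\beta^{-\beta}\,|g^{(\beta-1)}|_V}\cdot\frac{1}{N^{\beta}|x|^{\beta}}.$$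
   Context: Admissible weight functions: for $\beta\in\mathbb{N}$, $\beta\ge2$, a continuous function $g:\mathbb{R}\to\mathbb{R}$ is an admissible weight function of order $\beta$ if it is nonnegative, possesses a $(\beta-1)$-fold derivative $g^{(\beta-1)}$ of bounded variation, i.e. $$|g^{(\beta-1)}|_V:=\int_{\mathbb{R}}|\mathrm{d}g^{(\beta-1)}(z)|=\sup\sum_{j=0}^{n-1}\left|g^{(\beta-1)}(z_{j+1})-g^{(\beta-1)}(z_j)\right|<\infty,$$ where the supremum is taken over all strictly increasing real sequences $\{z_j\}_{j\in\mathbb{N}_0}$ (and all $n$), and satisfies the additional properties $\operatorname{supp} g=[-\frac12,\frac12]$, $g^{(\gamma)}(\pm\frac12)=0$ for $\gamma=0,\dots,\beta-1$, $g(z)>0$ for $|z|<\frac12$, and the normalisation $\|g\|_{L^1}=1$. The set of admissible weight functions of order $\beta$ is denoted by $BV_0^{\beta-1}$. Notation: $\zeta(\beta):=\sum_{r=1}^\infty r^{-\beta}$ for $\beta>1$, and $\|g\|_{1,N}:=\sum_{k=-N/2}^{N/2} g\left(\frac{k}{N}\right)$ is the norm of the samples. $2\mathbb{N}$ denotes the even positive integers.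
   Formalization: The denominator 2^{β-1}(2π)^β − ζ(β)β^{-β}|g^{(β-1)}|_V is assumed positive; if it is negative (possible for oscillating admissible g) the bound is negative and the claim false, and if it is zero the bound is undefined. *)

(* Defs.v *)
From Stdlib Require Import Reals ZArith.
From Coquelicot Require Import Coquelicot.

Open Scope R_scope.

(* Only meaningful for 2 <= beta; for smaller beta [Series] returns junk. *)
Definition zeta (beta : nat) : R :=
  Series (fun r : nat => / INR (S r) ^ beta).

(* The sums have at least one term; the empty sum, which is 0, does not
   affect the supremum. *)
Definition variation_sum (f : R -> R) (v : R) : Prop :=
  exists (z : nat -> R) (n : nat),
    (forall j : nat, z j < z (S j)) /\
    v = sum_n (fun j : nat => Rabs (f (z (S j)) - f (z j))) n.

Definition total_variation_bar (f : R -> R) : Rbar :=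
  Lub_Rbar (variation_sum f).

Definition bounded_variation (f : R -> R) : Prop :=
  is_finite (total_variation_bar f).

(* Equals 0 when the variation is infinite; used under [bounded_variation]. *)
Definition total_variation (f : R -> R) : R :=
  real (total_variation_bar f).

Definition support (f : R -> R) : R -> Prop :=
  adherence (fun z : R => f z <> 0).

(* [Derive_n] is total, so differentiability is required at every order up to
   [beta - 1], not only at the last one.  As g is continuous, the improper
   Riemann integral of |g| is its L^1 norm. *)
Record admissible_weight (beta : nat) (g : R -> R) : Prop := {
  aw_continuous : forall z : R, continuous g z;
  aw_nonneg : forall z : R, 0 <= g z;
  aw_derivable : forall gamma : nat, (gamma <= beta - 1)%nat ->
    forall z : R, ex_derive_n g gamma z;
  aw_bounded_variation : bounded_variation (Derive_n g (beta - 1));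
  aw_support : forall z : R, support g z <-> - (1 / 2) <= z <= 1 / 2;
  aw_boundary : forall gamma : nat, (gamma <= beta - 1)%nat ->
    Derive_n g gamma (- (1 / 2)) = 0 /\ Derive_n g gamma (1 / 2) = 0;
  aw_positive : forall z : R, Rabs z < 1 / 2 -> 0 < g z;
  aw_normalised :
    is_RInt_gen (fun z : R => Rabs (g z))
      (Rbar_locally m_infty) (Rbar_locally p_infty) 1
}.

(* The sum of f k over the integers a <= k <= b, zero if b < a. *)
Definition sum_int {G : AbelianMonoid} (a b : Z) (f : Z -> G) : G :=
  sum_n_m (fun j : nat => f (a + Z.of_nat j - 1)%Z) 1 (Z.to_nat (b - a + 1)).

(* e^{it} *)
Definition cis (t : R) : C := (cos t, sin t).

(* N is even wherever this is used, so the division is exact. *)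
Definition half (N : nat) : Z := (Z.of_nat N / 2)%Z.

Definition sample_norm (g : R -> R) (N : nat) : R :=
  sum_int (- half N) (half N) (fun k : Z => g (IZR k / INR N)).

Definition damping (g : R -> R) (N : nat) (k : Z) : R :=
  (g (IZR k / INR N) + g (IZR (k + 1) / INR N)) / (2 * sample_norm g N).

Definition kernel (g : R -> R) (N : nat) (x : R) : C :=
  sum_int (- half N) (half N - 1)
    (fun k : Z => Cmult (RtoC (damping g N k)) (cis (2 * PI * IZR k * x))).

(* Main.v *)
Require Import Defs.
From Stdlib Require Import Reals ZArith Lra Lia.
From Coquelicot Require Import Coquelicot.

Open Scope R_scope.

(** Put [T(x) = sum_(j <= N) g(j/N - 1/2) e^(2 pi i j x)].  Because [g] vanishes
    at [+-1/2], the averaging in the damping factors turns [K_N(x)] into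
    [T(x)] times a factor of modulus at most [2], divided by [2 T(0)]
    ([kernel_le]).  So the claim reduces to an upper bound for [|T(x)|] and a
    lower bound for [T(0)].

    The classical way to get both is Poisson summation,
    [T(x) = N sum_r ghat(N (x + r))] up to phases, together with the decay
    [|ghat(v)| <= V / (2 pi |v|)^beta], [V] being the variation of
    [g^(beta-1)].  Here a finite analogue replaces the Fourier transform.
    Sample [g] on a grid that is [M = 2 L + 1] times finer and call the
    resulting sum [T_M].  Orthogonality of the [M]-th roots of unity gives
    [M T(x) = sum_(|r| <= L) T_M((x + r)/M)] ([aliasing]).

    - Decay of [T_M]: [beta] summations by parts give
      [|2 sin(pi y)|^beta |T_M(y)| <= sum_i |nabla^beta g|], and the mean value
      theorem, applied [beta - 1] times to a signed sum of such differences,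
      bounds the right-hand side by [h^(beta-1) V], where [h = 1/(N M)] is the
      grid step ([trig_sum_decay]).
    - Since [sin u = u (1 + O(u^2))], the aliased terms are those of the Poisson
      sum up to a total error [O(1/M)] ([aliased_term_le]), which disappears as
      [L] grows ([le_of_le_plus_vanishing]).
    - For [|x| <= 1/2] one has [|x / (x +- n)| <= 1 / (2 n +- 1)], so that
      [sum_r |x / (x + r)|^beta] is at most twice the sum of the [beta]-th powers
      of the inverse odd numbers, [2 (1 - 2^-beta) zeta(beta)]
      ([sum_adjacent_odd_le]); this yields [trig_sum_bound].
    - At [x = 0] the central term [T_M(0)] is a Riemann sum, so
      [T_M(0) / M] tends to [N ||g||_1 = N], while the other terms contribute
      at most [2 zeta(beta) V / (N^(beta-1) (2 pi)^beta)]; this yields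
      [sample_sum_ge].

    Dividing the two bounds and using [N >= 2 beta] in the denominator gives the
    stated constant. *)

(** Equations between sums live in the carrier of an abstract monoid, which
    [ring] does not recognise as [C] or [R]. *)
Ltac ring_in T :=
  match goal with |- @eq _ ?a ?b => change (@eq T a b) end; ring.

(** * Unimodular numbers and finite sums *)

Lemma cis_plus (a b : R) : cis (a + b) = Cmult (cis a) (cis b).
Proof.
  unfold cis, Cmult; simpl. rewrite cos_plus, sin_plus. f_equal; ring.
Qed.

Lemma cis_0 : cis 0 = RtoC 1.
Proof. unfold cis; rewrite cos_0, sin_0; reflexivity. Qed.

Lemma Cmod_cis (t : R) : Cmod (cis t) = 1.
Proof.
  unfold Cmod, cis; simpl fst; simpl snd.
  replace (cos t ^ 2 + sin t ^ 2) with 1.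
  - apply sqrt_1.
  - generalize (sin2_cos2 t). unfold Rsqr. lra.
Qed.

Lemma cis_add_2PI (t : R) (k : nat) : cis (t + 2 * INR k * PI) = cis t.
Proof. unfold cis. rewrite cos_period, sin_period. reflexivity. Qed.

Lemma cis_2PI_nat (k : nat) : cis (2 * PI * INR k) = RtoC 1.
Proof.
  rewrite <- cis_0, <- (cis_add_2PI 0 k). f_equal. ring.
Qed.

Lemma Cmod_1_minus_cis (t : R) :
  Cmod (Cminus (RtoC 1) (cis t)) = 2 * Rabs (sin (t / 2)).
Proof.
  unfold Cmod, Cminus, Cplus, Copp, cis; simpl fst; simpl snd.
  replace ((1 + - cos t) ^ 2 + (0 + - sin t) ^ 2)
    with (Rsqr (2 * Rabs (sin (t / 2)))).
  - apply sqrt_Rsqr. generalize (Rabs_pos (sin (t / 2))). lra.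
  - rewrite Rsqr_mult, <- Rsqr_abs.
    assert (Hc : cos t = 1 - 2 * sin (t / 2) * sin (t / 2)).
    { rewrite <- cos_2a_sin. f_equal. field. }
    rewrite Hc.
    generalize (sin2_cos2 t). rewrite Hc. unfold Rsqr.
    set (s := sin t). set (u := sin (t / 2)). intros H. nra.
Qed.

Lemma sum_n_S_R (f : nat -> R) (n : nat) :
  sum_n f (S n) = sum_n f n + f (S n).
Proof. exact (sum_Sn f n). Qed.

Lemma sum_n_S_C (f : nat -> C) (n : nat) :
  sum_n f (S n) = Cplus (sum_n f n) (f (S n)).
Proof. exact (sum_Sn f n). Qed.

Lemma Cmod_sum_n_le (f : nat -> C) (b : nat -> R) (n : nat) :
  (forall i, (i <= n)%nat -> Cmod (f i) <= b i) ->
  Cmod (sum_n f n) <= sum_n b n.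
Proof.
  induction n as [|n IH]; intros H.
  - rewrite !sum_O. apply H. lia.
  - rewrite sum_n_S_C, sum_n_S_R.
    eapply Rle_trans; [apply Cmod_triangle|].
    apply Rplus_le_compat; [apply IH; intros; apply H|apply H]; lia.
Qed.

Lemma sum_n_le_loc (a b : nat -> R) (n : nat) :
  (forall i, (i <= n)%nat -> a i <= b i) -> sum_n a n <= sum_n b n.
Proof.
  induction n as [|n IH]; intros H.
  - rewrite !sum_O. apply H. lia.
  - rewrite !sum_n_S_R.
    apply Rplus_le_compat; [apply IH; intros; apply H|apply H]; lia.
Qed.

Lemma sum_n_vanish_tail (f : nat -> C) (n m : nat) :
  (forall i, (n < i)%nat -> f i = RtoC 0) -> sum_n f (n + m) = sum_n f n.
Proof.
  intros H. induction m as [|m IH].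
  - now rewrite Nat.add_0_r.
  - rewrite Nat.add_succ_r, sum_n_S_C, IH, H by lia. apply Cplus_0_r.
Qed.

Lemma sum_n_multiples (M : nat) (f : nat -> C) (N : nat) :
  (0 < M)%nat ->
  (forall i, ~ Nat.divide M i -> f i = RtoC 0) ->
  sum_n f (N * M) = sum_n (fun j => f (j * M)%nat) N.
Proof.
  intros HM Hf. induction N as [|N IH].
  - now rewrite !sum_O.
  - rewrite sum_n_S_C, <- IH.
    replace (S N * M)%nat with (S (N * M + (M - 1))) by lia.
    rewrite sum_n_S_C. f_equal.
    assert (Hk : forall k, (k < M)%nat ->
      sum_n f (N * M + k) = sum_n f (N * M)).
    { induction k as [|k IHk]; intros Hk.
      - now rewrite Nat.add_0_r.
      - rewrite Nat.add_succ_r, sum_n_S_C, IHk by lia.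
        rewrite Hf; [apply Cplus_0_r|].
        intros [q Hq].
        assert (N < q)%nat by nia. assert (q < S N)%nat by nia. lia. }
    apply Hk. lia.
Qed.

(** * Aliasing *)

(** The central term is kept apart because at [x = 0] it carries the main
    contribution; opposite indices are paired because the odd numbers [2 n +- 1]
    of the final estimate come from [n + x] and [n - x]. *)
Definition symmetric_sum (f : R -> C) (L : nat) : C :=
  Cplus (f 0)
    (sum_n_m (fun n => Cplus (f (INR n)) (f (- INR n))) 1 L).

Lemma symmetric_sum_S (f : R -> C) (L : nat) :
  symmetric_sum f (S L)
  = Cplus (symmetric_sum f L) (Cplus (f (INR (S L))) (f (- INR (S L)))).
Proof.
  unfold symmetric_sum. rewrite sum_n_Sm by lia.
  change plus with Cplus. ring.
Qed.

Lemma symmetric_sum_0 (f : R -> C) : symmetric_sum f 0 = f 0.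
Proof.
  unfold symmetric_sum. rewrite sum_n_m_zero by lia.
  change zero with (RtoC 0). ring.
Qed.

Lemma symmetric_sum_ext (f f' : R -> C) (L : nat) :
  (forall r, f r = f' r) -> symmetric_sum f L = symmetric_sum f' L.
Proof.
  intros H. induction L as [|L IH].
  - rewrite !symmetric_sum_0. apply H.
  - rewrite !symmetric_sum_S, IH, !H. reflexivity.
Qed.

Lemma symmetric_sum_scal (c : C) (f : R -> C) (L : nat) :
  symmetric_sum (fun r => Cmult c (f r)) L = Cmult c (symmetric_sum f L).
Proof.
  induction L as [|L IH].
  - rewrite !symmetric_sum_0. reflexivity.
  - rewrite !symmetric_sum_S, IH. ring.
Qed.

Lemma symmetric_sum_switch (F : nat -> R -> C) (n L : nat) :
  symmetric_sum (fun r => sum_n (fun i => F i r) n) L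
  = sum_n (fun i => symmetric_sum (F i) L) n.
Proof.
  induction n as [|n IH].
  - rewrite sum_O. apply symmetric_sum_ext. intros. now rewrite sum_O.
  - rewrite sum_n_S_C, <- IH. clear IH. induction L as [|L IH].
    + rewrite !symmetric_sum_0. apply sum_n_S_C.
    + rewrite !symmetric_sum_S, IH, !sum_n_S_C. ring.
Qed.

(** Multiplying by [1 - e^(it)] makes [sum_(|r| <= L) e^(irt)] telescope; this
    avoids dividing by a possibly vanishing factor. *)
Lemma dirichlet_kernel_telescopes (t : R) (L : nat) :
  Cmult (Cminus (RtoC 1) (cis t)) (symmetric_sum (fun r => cis (r * t)) L)
  = Cminus (cis (- INR L * t)) (cis ((INR L + 1) * t)).
Proof.
  induction L as [|L IH].
  - rewrite symmetric_sum_0. simpl INR.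
    replace (0 * t) with 0 by ring. replace (- 0 * t) with 0 by ring.
    replace ((0 + 1) * t) with t by ring. rewrite cis_0. ring.
  - rewrite symmetric_sum_S.
    rewrite Cmult_plus_distr_l, IH, S_INR.
    replace (cis ((INR L + 1 + 1) * t)) with (Cmult (cis t) (cis ((INR L + 1) * t)))
      by (rewrite <- cis_plus; f_equal; ring).
    replace (cis (- INR L * t)) with (Cmult (cis t) (cis (- (INR L + 1) * t)))
      by (rewrite <- cis_plus; f_equal; ring).
    ring.
Qed.

Lemma dirichlet_kernel_multiple (M j L : nat) : M = (2 * L + 1)%nat ->
  symmetric_sum (fun r => cis (r * (2 * PI * INR (j * M) / INR M))) L
  = RtoC (INR M).
Proof.
  intros HM.
  assert (HM0 : INR M <> 0) by (apply not_0_INR; lia).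
  assert (Hn : forall n : nat,
    cis (INR n * (2 * PI * INR (j * M) / INR M)) = RtoC 1 /\
    cis (- INR n * (2 * PI * INR (j * M) / INR M)) = RtoC 1).
  { intros n. rewrite mult_INR.
    replace (INR n * (2 * PI * (INR j * INR M) / INR M))
      with (2 * PI * INR (n * j)) by (rewrite mult_INR; field; assumption).
    replace (- INR n * (2 * PI * (INR j * INR M) / INR M))
      with (- (2 * PI * INR (n * j))) by (rewrite mult_INR; field; assumption).
    split; [apply cis_2PI_nat|].
    rewrite <- cis_0, <- (cis_add_2PI _ (n * j)). f_equal. ring. }
  set (f := fun r => cis (r * (2 * PI * INR (j * M) / INR M))).
  assert (Hl : forall l, symmetric_sum f l = RtoC (INR (2 * l + 1))).
  { induction l as [|l IH].
    - rewrite symmetric_sum_0. exact (proj1 (Hn 0%nat)).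
    - rewrite symmetric_sum_S, IH. unfold f.
      destruct (Hn (S l)) as [-> ->].
      replace (2 * S l + 1)%nat with (S (S (2 * l + 1))) by lia.
      rewrite !S_INR, !RtoC_plus. ring. }
  rewrite Hl, HM. reflexivity.
Qed.

(** With [t = 2 pi i / M] and [M = 2 L + 1] the two end terms of the telescoped
    sum coincide, and [e^(it) <> 1] when [M] does not divide [i]. *)
Lemma dirichlet_kernel_other (M i L : nat) : M = (2 * L + 1)%nat ->
  ~ Nat.divide M i ->
  symmetric_sum (fun r => cis (r * (2 * PI * INR i / INR M))) L = RtoC 0.
Proof.
  intros HM Hi.
  assert (HM0 : 0 < INR M) by (apply lt_0_INR; lia).
  set (t := 2 * PI * INR i / INR M).
  assert (Hne : Cminus (RtoC 1) (cis t) <> RtoC 0).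
  { intros E. apply Hi.
    assert (Hs : sin (t / 2) = 0).
    { generalize (Cmod_1_minus_cis t). rewrite E, Cmod_0. intros H.
      apply Rabs_eq_0. lra. }
    apply sin_eq_0_0 in Hs. destruct Hs as [k Hk].
    assert (Hik : INR i = IZR k * INR M).
    { unfold t in Hk. generalize PI_RGT_0. intros HP.
      apply (Rmult_eq_reg_r (PI / INR M)).
      - transitivity (2 * PI * INR i / INR M / 2); [field; lra|].
        rewrite Hk. field. lra.
      - apply Rgt_not_eq. apply Rdiv_lt_0_compat; assumption. }
    rewrite !INR_IZR_INZ, <- mult_IZR in Hik. apply eq_IZR in Hik.
    exists (Z.to_nat k). nia. }
  assert (H := dirichlet_kernel_telescopes t L).
  assert (Hp : cis ((INR L + 1) * t) = cis (- INR L * t)).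
  { rewrite <- (cis_add_2PI (- INR L * t) i). f_equal.
    unfold t. replace (INR M) with (2 * INR L + 1).
    - field. generalize (pos_INR L). lra.
    - rewrite HM, plus_INR, mult_INR. simpl. ring. }
  rewrite Hp in H.
  destruct (Ceq_dec (symmetric_sum (fun r => cis (r * t)) L) (RtoC 0))
    as [E|E]; [exact E|exfalso].
  apply (Cmult_neq_0 _ _ Hne E). rewrite H. ring.
Qed.

(** The window always starts at index [0]; recentring it at the origin only
    changes the sum by a unimodular factor. *)
Definition trig_sum (b : nat -> R) (n : nat) (y : R) : C :=
  sum_n (fun i => Cmult (RtoC (b i)) (cis (2 * PI * INR i * y))) n.

(** Averaging a trigonometric sum over the [M] translates [(x + r)/M] keeps
    exactly the samples with index divisible by [M].  The translates are centred
    at [x/M], so that for [|x| <= 1/2] the points [(x + r)/M] lie between [-1/2] and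
    [1/2], where [sin(pi y)] is comparable to [y]. *)
Lemma aliasing (b : nat -> R) (N M L : nat) (x : R) : M = (2 * L + 1)%nat ->
  symmetric_sum (fun r => trig_sum b (N * M) ((x + r) / INR M)) L
  = Cmult (RtoC (INR M)) (trig_sum (fun j => b (j * M)%nat) N x).
Proof.
  intros HM. unfold trig_sum.
  assert (HM0 : INR M <> 0) by (apply not_0_INR; lia).
  rewrite symmetric_sum_switch.
  set (D := fun i => symmetric_sum (fun r => cis (r * (2 * PI * INR i / INR M))) L).
  transitivity (sum_n (fun i => Cmult (Cmult (RtoC (b i))
      (cis (2 * PI * INR i * x / INR M))) (D i)) (N * M)).
  { apply sum_n_ext. intros i. unfold D.
    rewrite <- symmetric_sum_scal. apply symmetric_sum_ext. intros r.
    rewrite <- Cmult_assoc, <- cis_plus. do 2 f_equal. field. exact HM0. }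
  rewrite sum_n_multiples; [|lia|].
  - etransitivity; [|apply (sum_n_mult_l (K := C_Ring))].
    apply sum_n_ext. intros j. unfold D.
    rewrite (dirichlet_kernel_multiple M j L HM). change mult with Cmult.
    rewrite mult_INR.
    replace (2 * PI * (INR j * INR M) * x / INR M) with (2 * PI * INR j * x)
      by (field; exact HM0).
    ring_in C.
  - intros i Hi. unfold D. rewrite (dirichlet_kernel_other M i L HM Hi). apply Cmult_0_r.
Qed.

(** * Iterated differences of a function of bounded variation *)

Definition backward_diff (h : R) (F : R -> R) (z : R) : R := F z - F (z - h).

Definition iter_diff (h : R) (m : nat) (F : R -> R) : R -> R :=
  Nat.iter m (backward_diff h) F.

Definition signed_increments (e : nat -> R) (h : R) (n : nat) (F : R -> R)
    (s : R) : R :=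
  sum_n (fun i => e i * backward_diff h F (s + INR i * h)) n.

Lemma backward_diff_derive (h : R) (F F' : R -> R) :
  (forall z, is_derive F z (F' z)) ->
  forall z, is_derive (backward_diff h F) z (backward_diff h F' z).
Proof.
  intros H z. unfold backward_diff.
  apply (is_derive_minus (V := R_NormedModule)); [apply H|].
  replace (F' (z - h)) with (scal 1 (F' (z - h)))
    by (apply Rmult_1_l).
  apply (is_derive_comp F (fun t => t - h)); [apply H|].
  auto_derive; trivial.
Qed.

Lemma signed_increments_derive (e : nat -> R) (h : R) (n : nat)
    (F F' : R -> R) :
  (forall z, is_derive F z (F' z)) ->
  forall s, is_derive (signed_increments e h n F) s
              (signed_increments e h n F' s).
Proof.
  intros H s. unfold signed_increments.
  apply (is_derive_sum_n (V := R_NormedModule)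
    (fun i s => e i * backward_diff h F (s + INR i * h))).
  intros k _.
  apply (is_derive_scal (fun s => backward_diff h F (s + INR k * h))).
  replace (backward_diff h F' (s + INR k * h))
    with (scal 1 (backward_diff h F' (s + INR k * h))) by (apply Rmult_1_l).
  apply (is_derive_comp (backward_diff h F) (fun t => t + INR k * h)).
  - now apply backward_diff_derive.
  - auto_derive; trivial.
Qed.

Lemma signed_increments_diff (e : nat -> R) (h : R) (n : nat) (F : R -> R)
    (s : R) :
  signed_increments e h n (backward_diff h F) s
  = signed_increments e h n F s - signed_increments e h n F (s - h).
Proof.
  unfold signed_increments. induction n as [|n IH].
  - rewrite !sum_O. unfold backward_diff.
    replace (s - h + INR 0 * h) with (s + INR 0 * h - h) by ring. ring.
  - rewrite !sum_n_S_R, IH. unfold backward_diff.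
    replace (s - h + INR (S n) * h) with (s + INR (S n) * h - h) by ring. ring.
Qed.

Lemma mean_value (F F' : R -> R) (a b : R) :
  (forall z, is_derive F z (F' z)) ->
  exists c, Rmin a b <= c <= Rmax a b /\ F b - F a = F' c * (b - a).
Proof.
  intros H. apply MVT_gen.
  - intros z _. apply H.
  - intros z _. apply continuity_pt_filterlim.
    apply (ex_derive_continuous (V := R_NormedModule)).
    exists (F' z). apply H.
Qed.

(** Each difference operator commutes with the signed sum and becomes, by the
    mean value theorem, a factor [h] and a derivative at an unknown point.  One
    common point serves all terms because the theorem is applied to the whole
    signed sum; hence no integral representation of the differences is needed.
    The family [G] stands for [g] and its successive derivatives. *)
Lemma iterated_mean_value (e : nat -> R) (h : R) (n m : nat) :
  forall (G : nat -> R -> R),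
  (forall k, (k < m)%nat -> forall z, is_derive (G k) z (G (S k) z)) ->
  forall s0, exists s,
    signed_increments e h n (iter_diff h m (G 0%nat)) s0
    = h ^ m * signed_increments e h n (G m) s.
Proof.
  induction m as [|m IH]; intros G HG s0.
  - exists s0. simpl. ring.
  - destruct (IH (fun k => backward_diff h (G k))) with (s0 := s0) as [s Hs].
    { intros k Hk. apply backward_diff_derive. apply HG. lia. }
    destruct (mean_value (signed_increments e h n (G m))
                (signed_increments e h n (G (S m))) (s - h) s) as [c [_ Hc]].
    { apply signed_increments_derive. apply HG. lia. }
    exists c.
    unfold iter_diff. rewrite Nat.iter_succ_r.
    fold (iter_diff h m (backward_diff h (G 0%nat))).
    rewrite Hs, signed_increments_diff, Hc. simpl. ring.
Qed.

Lemma variation_sum_le (f : R -> R) (z : nat -> R) (n : nat) :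
  Defs.bounded_variation f -> (forall j, z j < z (S j)) ->
  sum_n (fun j => Rabs (f (z (S j)) - f (z j))) n <= total_variation f.
Proof.
  unfold Defs.bounded_variation, total_variation, total_variation_bar. intros Hb Hz.
  destruct (Lub_Rbar_correct (variation_sum f)) as [Hub _].
  rewrite <- Hb in Hub.
  apply (Hub _). exists z, n. split; [exact Hz|reflexivity].
Qed.

Lemma total_variation_pos (f : R -> R) :
  Defs.bounded_variation f -> 0 <= total_variation f.
Proof.
  intros Hb. eapply Rle_trans; [|apply (variation_sum_le f INR 0 Hb)].
  - rewrite sum_O. apply Rabs_pos.
  - intros j. rewrite S_INR. lra.
Qed.

Lemma signed_increments_le (e : nat -> R) (h : R) (n : nat) (F : R -> R)
    (s : R) :
  Defs.bounded_variation F -> 0 < h -> (forall i, Rabs (e i) <= 1) ->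
  signed_increments e h n F s <= total_variation F.
Proof.
  intros HF Hh He.
  eapply Rle_trans;
    (* The first backward difference reaches back to [s - h]. *)
    [|apply (variation_sum_le F (fun j => s + (INR j - 1) * h) n HF)].
  - apply sum_n_le_loc. intros i _.
    unfold backward_diff. rewrite S_INR.
    replace (s + (INR i + 1 - 1) * h) with (s + INR i * h) by ring.
    replace (s + (INR i - 1) * h) with (s + INR i * h - h) by ring.
    set (d := F _ - F _).
    eapply Rle_trans; [apply Rle_abs|]. rewrite Rabs_mult.
    rewrite <- (Rmult_1_l (Rabs d)) at 2.
    apply Rmult_le_compat_r; [apply Rabs_pos|apply He].
  - intros j. rewrite S_INR. nra.
Qed.

(** Choosing the signs of the differences themselves turns a sum of absolute
    values into a signed sum, to which the mean value theorem applies. *)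
Lemma sum_abs_iter_diff_le (h : R) (n m : nat) (G : nat -> R -> R) (s : R) :
  (forall k, (k < m)%nat -> forall z, is_derive (G k) z (G (S k) z)) ->
  Defs.bounded_variation (G m) -> 0 < h ->
  sum_n (fun i => Rabs (iter_diff h (S m) (G 0%nat) (s + INR i * h))) n
  <= h ^ m * total_variation (G m).
Proof.
  intros HG HV Hh.
  set (d := fun i => iter_diff h (S m) (G 0%nat) (s + INR i * h)).
  set (e := fun i => if Rle_dec 0 (d i) then 1 else -1).
  destruct (iterated_mean_value e h n m G HG s) as [c Hc].
  apply Rle_trans with (signed_increments e h n (iter_diff h m (G 0%nat)) s).
  - apply sum_n_le_loc. intros i _.
    change (Rabs (d i) <= e i * d i). unfold e.
    destruct (Rle_dec 0 (d i)); [rewrite Rabs_pos_eq|rewrite Rabs_left1]; lra.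
  - rewrite Hc. apply Rmult_le_compat_l; [apply pow_le; lra|].
    apply signed_increments_le; try assumption.
    intros i. unfold e.
    destruct (Rle_dec 0 (d i)); [rewrite Rabs_pos_eq|rewrite Rabs_left1]; lra.
Qed.

Lemma iter_diff_S (h : R) (m : nat) (F : R -> R) (z : R) :
  iter_diff h (S m) F z = iter_diff h m F z - iter_diff h m F (z - h).
Proof. reflexivity. Qed.

Lemma iter_diff_vanish_left (h a : R) (m : nat) (F : R -> R) : 0 < h ->
  (forall z, z <= a -> F z = 0) -> forall z, z <= a -> iter_diff h m F z = 0.
Proof.
  intros Hh HF. induction m as [|m IH]; intros z Hz.
  - now apply HF.
  - rewrite iter_diff_S, !IH by lra. ring.
Qed.

Lemma iter_diff_vanish_right (h a : R) (m : nat) (F : R -> R) : 0 < h ->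
  (forall z, a <= z -> F z = 0) ->
  forall z, a + INR m * h <= z -> iter_diff h m F z = 0.
Proof.
  intros Hh HF. induction m as [|m IH]; intros z Hz.
  - apply HF. simpl in Hz. lra.
  - rewrite S_INR in Hz. rewrite iter_diff_S, !IH by lra. ring.
Qed.

(** The boundary term is kept explicitly: it involves [F] at the end of the window,
    where the iterated differences vanish only if the window is long enough. *)
Lemma summation_by_parts (F : R -> R) (s h : R) (n : nat) (y : R) :
  F (s - h) = 0 ->
  trig_sum (fun i => backward_diff h F (s + INR i * h)) n y
  = Cminus
      (Cmult (Cminus (RtoC 1) (cis (2 * PI * y)))
             (trig_sum (fun i => F (s + INR i * h)) n y))
      (Copp (Cmult (RtoC (F (s + INR n * h))) (cis (2 * PI * INR (S n) * y)))).
Proof.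
  intros H0. unfold trig_sum, backward_diff. induction n as [|n IH].
  - rewrite !sum_O. rewrite S_INR. simpl INR.
    replace (s + 0 * h) with s by ring. rewrite H0.
    replace (2 * PI * 0 * y) with 0 by ring.
    replace (2 * PI * (0 + 1) * y) with (2 * PI * y) by ring.
    rewrite cis_0, Rminus_0_r. ring.
  - rewrite !sum_n_S_C, IH.
    replace (cis (2 * PI * INR (S (S n)) * y))
      with (Cmult (cis (2 * PI * y)) (cis (2 * PI * INR (S n) * y)))
      by (rewrite <- cis_plus; f_equal; rewrite !S_INR; ring).
    replace (s + INR (S n) * h - h) with (s + INR n * h)
      by (rewrite S_INR; ring).
    rewrite RtoC_minus. ring.
Qed.

(** Each difference enlarges the support of [F] by one grid step to the right,
    so a window prolonged by [k] steps accommodates [k] differences. *)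
Lemma trig_sum_iter_diff (F : R -> R) (a h : R) (n m k : nat) (y : R) :
  0 < h ->
  (forall z, z <= a -> F z = 0) ->
  (forall z, a + INR n * h <= z -> F z = 0) ->
  (m <= k)%nat ->
  trig_sum (fun i => iter_diff h m F (a + INR i * h)) (n + k) y
  = Cmult (Cpow (Cminus (RtoC 1) (cis (2 * PI * y))) m)
      (trig_sum (fun i => F (a + INR i * h)) (n + k) y).
Proof.
  intros Hh Hl Hr. induction m as [|m IH]; intros Hm.
  - simpl. rewrite Cmult_1_l. reflexivity.
  - change (fun i => iter_diff h (S m) F (a + INR i * h))
      with (fun i => backward_diff h (iter_diff h m F) (a + INR i * h)).
    rewrite summation_by_parts.
    + rewrite IH by lia.
      rewrite (iter_diff_vanish_right h (a + INR n * h) m F Hh Hr).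
      * simpl. ring.
      * rewrite plus_INR. assert (INR m <= INR k) by (apply le_INR; lia). nra.
    + apply (iter_diff_vanish_left h a m F Hh Hl). lra.
Qed.

Lemma trig_sum_decay (m n : nat) (G : nat -> R -> R) (a h y : R) :
  0 < h ->
  (forall k, (k < m)%nat -> forall z, is_derive (G k) z (G (S k) z)) ->
  Defs.bounded_variation (G m) ->
  (forall z, z <= a -> G 0%nat z = 0) ->
  (forall z, a + INR n * h <= z -> G 0%nat z = 0) ->
  (2 * Rabs (sin (PI * y))) ^ S m
    * Cmod (trig_sum (fun i => G 0%nat (a + INR i * h)) n y)
  <= h ^ m * total_variation (G m).
Proof.
  intros Hh HG HV Hl Hr.
  replace (trig_sum (fun i => G 0%nat (a + INR i * h)) n y)
    with (trig_sum (fun i => G 0%nat (a + INR i * h)) (n + S m) y).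
  (* [S m] extra terms, all zero, make room for [S m] differences. *)
  2:{ apply sum_n_vanish_tail. intros i Hi. rewrite Hr; [ring|].
      apply lt_INR in Hi. nra. }
  replace (PI * y) with ((2 * PI * y) / 2) by field.
  rewrite <- Cmod_1_minus_cis, <- Cmod_pow, <- Cmod_mult.
  rewrite <- trig_sum_iter_diff by (assumption || lia).
  eapply Rle_trans; [apply Cmod_sum_n_le|apply (sum_abs_iter_diff_le h (n + S m) m G a HG HV Hh)].
  intros i _. rewrite Cmod_mult, Cmod_cis, Cmod_R, Rmult_1_r. apply Rle_refl.
Qed.

(** * Scalar inequalities *)

Lemma le_of_le_plus_vanishing (a b c : R) :
  (forall L : nat, a <= b + c / INR (2 * L + 1)) -> a <= b.
Proof.
  intros H. apply Rnot_lt_le. intros Hlt.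
  destruct (INR_unbounded (c / (a - b))) as [L HL].
  specialize (H L).
  assert (Hp : INR L < INR (2 * L + 1)) by (apply lt_INR; lia).
  assert (H0 : 0 <= INR L) by apply pos_INR.
  set (M := INR (2 * L + 1)) in *.
  assert (c < (a - b) * M).
  { apply (Rmult_lt_compat_l (a - b)) in HL; [|lra].
    replace ((a - b) * (c / (a - b))) with c in HL by (field; lra). nra. }
  assert (c / M < a - b).
  { apply (Rmult_lt_reg_r M); [lra|].
    unfold Rdiv. rewrite Rmult_assoc, Rinv_l; lra. }
  lra.
Qed.

(** From [sin u >= u - u^3/6] it suffices that [(1 + t)(1 - t/6) >= 1] for
    [t = u^2], which holds for [0 <= t <= 5]. *)
Lemma le_mult_sin (u : R) : 0 < u <= PI / 2 -> u <= (1 + u ^ 2) * sin u.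
Proof.
  intros [H0 H1]. generalize PI_4 PI_RGT_0. intros H4 HP.
  destruct (sin_bound u 0) as [Hs _]; [lra|lra|].
  unfold sin_approx, sin_term in Hs. simpl in Hs.
  assert (u - u ^ 3 / 6 <= sin u) by (simpl; lra).
  assert (0 <= (1 + u ^ 2) * (sin u - (u - u ^ 3 / 6))).
  { apply Rmult_le_pos; nra. }
  assert (u <= 2) by lra.
  assert (0 <= u ^ 3 * (5 - u ^ 2)).
  { apply Rmult_le_pos; [apply pow_le; lra|nra]. }
  nra.
Qed.

Lemma pow_1_plus_le (T : R) (m : nat) : 0 <= T ->
  exists C, 0 <= C /\ forall t, 0 <= t <= T -> (1 + t) ^ m <= 1 + C * t.
Proof.
  intros HT. induction m as [|m [C [HC IH]]].
  - exists 0. split; [lra|]. intros t _. simpl. lra.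
  - exists (1 + C + C * T). split; [nra|]. intros t Ht.
    specialize (IH t Ht). simpl.
    assert ((1 + t) * (1 + t) ^ m <= (1 + t) * (1 + C * t))
      by (apply Rmult_le_compat_l; lra).
    assert (C * t * t <= C * t * T) by (apply Rmult_le_compat_l; nra).
    nra.
Qed.

(** Here [q = |x|] or [q = 1], and [y = x + r].  With [u = pi |y| / M] the
    correction factor [(u / sin u)^beta] is at most [1 + C' u^2], and
    [(q / |y|)^beta u^2 = O(1/M^2)] because [beta >= 2] and [q <= |y|]: the error
    is uniform in [y], so the [M] aliased terms together err by [O(1/M)]. *)
Lemma aliased_term_le (beta : nat) : (2 <= beta)%nat ->
  exists C, 0 <= C /\ forall q y M, 0 < q <= 1 -> q <= Rabs y ->
    0 < M -> Rabs y <= M / 2 ->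
    q ^ beta <= (M * (2 * Rabs (sin (PI * (y / M))))) ^ beta
                * (/ (2 * PI) ^ beta * ((q / Rabs y) ^ beta + C / M ^ 2)).
Proof.
  intros Hb.
  (* u <= pi/2 <= 2, hence u^2 <= 4. *)
  destruct (pow_1_plus_le 4 beta) as [C [HC Hpow]]; [lra|].
  (* 16 bounds pi^2 q^2. *)
  exists (16 * C). split; [lra|].
  intros q y M Hq Hqy HM HyM.
  generalize PI_4 PI_RGT_0. intros H4 HP.
  assert (Hy : 0 < Rabs y) by lra.
  assert (HiM : 0 < / M) by now apply Rinv_0_lt_compat.
  set (u := PI * Rabs y / M).
  assert (Hu : 0 < u <= PI / 2).
  { unfold u, Rdiv. split.
    - apply Rmult_lt_0_compat; [apply Rmult_lt_0_compat|]; assumption.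
    - rewrite Rmult_assoc. apply Rmult_le_compat_l; [lra|].
      apply (Rmult_le_reg_r M); [assumption|].
      rewrite Rmult_assoc, Rinv_l; lra. }
  assert (Hsin : Rabs (sin (PI * (y / M))) = sin u).
  { assert (0 < sin u) by (apply sin_gt_0; lra).
    destruct (Rcase_abs y) as [Hn|Hp].
    - replace (PI * (y / M)) with (- u)
        by (unfold u; rewrite (Rabs_left y) by assumption; field; lra).
      rewrite sin_neg, Rabs_Ropp. apply Rabs_pos_eq. lra.
    - replace (PI * (y / M)) with u
        by (unfold u; rewrite (Rabs_right y) by assumption; field; lra).
      apply Rabs_pos_eq. lra. }
  rewrite Hsin.
  set (rho := q / Rabs y).
  assert (Hrho : 0 <= rho <= 1).
  { unfold rho. split.
    - apply Rdiv_le_0_compat; lra.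
    - apply (Rmult_le_reg_r (Rabs y)); [assumption|].
      unfold Rdiv. rewrite Rmult_assoc, Rinv_l; lra. }
  assert (H1 : q ^ beta <=
    (M * (2 * sin u)) ^ beta * (/ (2 * PI) ^ beta * (rho ^ beta * (1 + u ^ 2) ^ beta))).
  { rewrite <- pow_inv, <- !Rpow_mult_distr.
    apply pow_incr. split; [lra|].
    replace q with (M * (2 * u) * (/ (2 * PI) * rho))
      by (unfold u, rho; field; lra).
    replace (M * (2 * sin u) * (/ (2 * PI) * (rho * (1 + u ^ 2))))
      with (M * (2 * ((1 + u ^ 2) * sin u)) * (/ (2 * PI) * rho)) by ring.
    assert (0 < / (2 * PI)) by (apply Rinv_0_lt_compat; lra).
    apply Rmult_le_compat_r; [apply Rmult_le_pos; lra|].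
    apply Rmult_le_compat_l; [lra|].
    apply Rmult_le_compat_l; [lra|]. now apply le_mult_sin. }
  eapply Rle_trans; [exact H1|].
  apply Rmult_le_compat_l.
  { apply pow_le. assert (0 < sin u) by (apply sin_gt_0; lra). nra. }
  apply Rmult_le_compat_l.
  { left. apply Rinv_0_lt_compat, pow_lt. lra. }
  assert (H2 : (1 + u ^ 2) ^ beta <= 1 + C * u ^ 2) by (apply Hpow; nra).
  assert (Hr0 : 0 <= rho ^ beta) by (apply pow_le; lra).
  apply Rle_trans with (rho ^ beta * (1 + C * u ^ 2)).
  { now apply Rmult_le_compat_l. }
  enough (rho ^ beta * u ^ 2 <= 16 / M ^ 2) by
    (replace (16 * C / M ^ 2) with (C * (16 / M ^ 2)) by (field; lra); nra).
  replace beta with (2 + (beta - 2))%nat by lia. rewrite pow_add.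
  assert (Hr2 : rho ^ (beta - 2) <= 1).
  { rewrite <- (pow1 (beta - 2)). now apply pow_incr. }
  assert (Hr3 : 0 <= rho ^ (beta - 2)) by (apply pow_le; lra).
  replace (rho ^ 2 * rho ^ (beta - 2) * u ^ 2)
    with (((q * PI) ^ 2 * / M ^ 2) * rho ^ (beta - 2))
    by (unfold rho, u; field; lra).
  assert (Hm2 : 0 < / M ^ 2) by (apply Rinv_0_lt_compat, pow_lt; lra).
  assert ((q * PI) ^ 2 <= 16).
  { replace 16 with (4 ^ 2) by ring. apply pow_incr. nra. }
  assert (0 <= (q * PI) ^ 2) by apply pow2_ge_0.
  unfold Rdiv. rewrite <- (Rmult_1_r (16 * / M ^ 2)).
  apply Rmult_le_compat; try nra.
Qed.

(** * Partial sums of the zeta series *)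

Definition inv_pow (beta : nat) (r : nat) : R := / INR r ^ beta.

Lemma inv_pow_pos (beta r : nat) : (0 < r)%nat -> 0 < inv_pow beta r.
Proof. intros H. apply Rinv_0_lt_compat, pow_lt, lt_0_INR, H. Qed.

(** Compare with the telescoping series of [1/(n (n + 1))]. *)
Lemma sum_inv_pow_bounded (beta n : nat) : (2 <= beta)%nat ->
  sum_n (fun r => inv_pow beta (S r)) n <= 2 - / INR (S n).
Proof.
  intros Hb.
  assert (Hle : forall r, inv_pow beta (S r) <= / INR (S r) ^ 2).
  { intros r. apply Rinv_le_contravar.
    - apply pow_lt, lt_0_INR. lia.
    - apply Rle_pow; [|exact Hb]. rewrite S_INR. generalize (pos_INR r). lra. }
  induction n as [|n IH].
  - rewrite sum_O. eapply Rle_trans; [apply Hle|]. simpl. lra.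
  - rewrite sum_n_S_R. generalize (Hle (S n)). intros H.
    enough (/ INR (S (S n)) ^ 2 <= / INR (S n) - / INR (S (S n))) by lra.
    rewrite (S_INR (S n)). assert (0 < INR (S n)) by (apply lt_0_INR; lia).
    set (t := INR (S n)) in *.
    replace (/ t - / (t + 1)) with (/ (t * (t + 1))) by (field; lra).
    apply Rinv_le_contravar; nra.
Qed.

Lemma sum_inv_pow_cv (beta : nat) : (2 <= beta)%nat ->
  is_lim_seq (sum_n (fun r => inv_pow beta (S r))) (zeta beta).
Proof.
  intros Hb.
  destruct (ex_finite_lim_seq_incr (sum_n (fun r => inv_pow beta (S r))) 2)
    as [l Hl].
  - intros n. rewrite sum_n_S_R.
    generalize (inv_pow_pos beta (S (S n))). intros H. specialize (H ltac:(lia)). lra.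
  - intros n. generalize (sum_inv_pow_bounded beta n Hb).
    assert (0 < / INR (S n)) by (apply Rinv_0_lt_compat, lt_0_INR; lia). lra.
  - replace (zeta beta) with l; [exact Hl|].
    symmetry. apply is_series_unique. exact Hl.
Qed.

Lemma sum_inv_pow_le_zeta (beta n : nat) : (2 <= beta)%nat ->
  sum_n (fun r => inv_pow beta (S r)) n <= zeta beta.
Proof.
  intros Hb. apply (is_lim_seq_incr_compare _ _ (sum_inv_pow_cv beta Hb)).
  intros k. rewrite sum_n_S_R.
  generalize (inv_pow_pos beta (S (S k))). intros H. specialize (H ltac:(lia)). lra.
Qed.

Definition odd_inv_pow (beta n : nat) : R := inv_pow beta (2 * n + 1).

Lemma odd_inv_pow_pos (beta n : nat) : 0 < odd_inv_pow beta n.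
Proof. apply inv_pow_pos. lia. Qed.

Lemma sum_odd_even_split (beta n : nat) :
  sum_n (odd_inv_pow beta) n + / 2 ^ beta * sum_n (fun r => inv_pow beta (S r)) n
  = sum_n (fun r => inv_pow beta (S r)) (2 * n + 1).
Proof.
  assert (He : forall k, inv_pow beta (2 * k) = / 2 ^ beta * inv_pow beta k).
  { intros k. unfold inv_pow. rewrite mult_INR, Rpow_mult_distr, Rinv_mult.
    reflexivity. }
  induction n as [|n IH].
  - simpl (2 * 0 + 1)%nat. rewrite sum_n_S_R, !sum_O.
    change (inv_pow beta 2) with (inv_pow beta (2 * 1)). rewrite He. reflexivity.
  - replace (2 * S n + 1)%nat with (S (S (2 * n + 1))) by lia.
    rewrite !sum_n_S_R, <- IH.
    replace (inv_pow beta (S (S (S (2 * n + 1)))))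
      with (/ 2 ^ beta * inv_pow beta (S (S n)))
      by (rewrite <- He; f_equal; lia).
    replace (inv_pow beta (S (S (2 * n + 1)))) with (odd_inv_pow beta (S n))
      by (unfold odd_inv_pow; f_equal; lia).
    ring.
Qed.

Lemma sum_n_mono (a : nat -> R) (n k : nat) :
  (forall i, 0 <= a i) -> sum_n a n <= sum_n a (n + k).
Proof.
  intros H. induction k as [|k IH].
  - rewrite Nat.add_0_r. apply Rle_refl.
  - rewrite Nat.add_succ_r, sum_n_S_R. generalize (H (S (n + k))). lra.
Qed.

(** The full series splits into its odd part and [2^-beta] times itself.  A
    finite odd sum is compared with this identity truncated at an arbitrarily
    large index. *)
Lemma sum_odd_le (beta n : nat) : (2 <= beta)%nat ->
  sum_n (odd_inv_pow beta) n <= (1 - / 2 ^ beta) * zeta beta.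
Proof.
  intros Hb.
  assert (H2 : 0 < 2 ^ beta) by (apply pow_lt; lra).
  assert (Hi : 0 < / 2 ^ beta) by now apply Rinv_0_lt_compat.
  set (O := sum_n (odd_inv_pow beta)).
  set (H := sum_n (fun r => inv_pow beta (S r))).
  assert (Hk : forall k, H k <= 2 ^ beta * (zeta beta - O n)).
  { intros k.
    assert (E := sum_odd_even_split beta (n + k)). fold O H in E.
    assert (E1 : O n <= O (n + k)%nat).
    { apply sum_n_mono. intros i. left. apply odd_inv_pow_pos. }
    assert (E2 : H k <= H (n + k)%nat).
    { rewrite Nat.add_comm. apply sum_n_mono. intros i. left.
      apply inv_pow_pos. lia. }
    assert (E3 := sum_inv_pow_le_zeta beta (2 * (n + k) + 1) Hb). fold H in E3.
    apply (Rmult_le_reg_l (/ 2 ^ beta)); [exact Hi|].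
    rewrite <- Rmult_assoc, Rinv_l, Rmult_1_l by lra. nra. }
  assert (Hz : zeta beta <= 2 ^ beta * (zeta beta - O n)).
  { apply (is_lim_seq_le H (fun _ => 2 ^ beta * (zeta beta - O n))
             (zeta beta) (2 ^ beta * (zeta beta - O n)) Hk).
    - now apply sum_inv_pow_cv.
    - apply is_lim_seq_const. }
  apply (Rmult_le_compat_l (/ 2 ^ beta)) in Hz; [|lra].
  rewrite <- Rmult_assoc, Rinv_l, Rmult_1_l in Hz by lra. lra.
Qed.

Lemma sum_n_m_1_S (a : nat -> R) (L : nat) :
  sum_n_m a 1 (S L) = sum_n_m a 1 L + a (S L).
Proof. apply (sum_n_Sm a). lia. Qed.

Lemma sum_n_m_1_0 (a : nat -> R) : sum_n_m a 1 0 = 0.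
Proof. apply (sum_n_m_zero a). lia. Qed.

(** The worst case [|x| = 1/2] of [sum_r |x / (x + r)|^beta], in which, apart
    from truncation, every inverse odd number occurs twice; the leading [1] is the term [r = 0]. *)
Lemma sum_adjacent_odd_le (beta L : nat) : (2 <= beta)%nat ->
  1 + sum_n_m (fun n => odd_inv_pow beta n + odd_inv_pow beta (n - 1)) 1 L
  <= 2 * ((1 - / 2 ^ beta) * zeta beta).
Proof.
  intros Hb.
  assert (H : 1 + sum_n_m (fun n => odd_inv_pow beta n + odd_inv_pow beta (n - 1)) 1 L
              = 2 * sum_n (odd_inv_pow beta) L - odd_inv_pow beta L).
  { induction L as [|L IH].
    - rewrite sum_n_m_1_0, sum_O. unfold odd_inv_pow, inv_pow. simpl.
      rewrite pow1. field.
    - rewrite sum_n_m_1_S, sum_n_S_R, <- Rplus_assoc, IH.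
      replace (S L - 1)%nat with L by lia. ring. }
  rewrite H. generalize (sum_odd_le beta L Hb) (odd_inv_pow_pos beta L). lra.
Qed.

Lemma sum_n_m_1_inv_pow_le (beta L : nat) : (2 <= beta)%nat ->
  sum_n_m (inv_pow beta) 1 L <= zeta beta.
Proof.
  intros Hb. destruct L as [|L].
  - rewrite sum_n_m_1_0. eapply Rle_trans; [|apply (sum_inv_pow_le_zeta beta 0 Hb)].
    rewrite sum_O. left. apply inv_pow_pos. lia.
  - rewrite <- (sum_n_m_S (inv_pow beta) 0 L). now apply sum_inv_pow_le_zeta.
Qed.

(** Both cases say that [a <= 1/2] forces [n +- a >= (2 n +- 1) a]. *)
Lemma ratio_pow_le (beta n : nat) (a d : R) :
  0 < a <= 1 / 2 -> (0 < n)%nat ->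
  (INR n + a <= d -> (a / d) ^ beta <= odd_inv_pow beta n) /\
  (INR n - a <= d -> (a / d) ^ beta <= odd_inv_pow beta (n - 1)).
Proof.
  intros Ha Hn.
  assert (H1 : 1 <= INR n) by (apply (le_INR 1); lia).
  assert (H : forall k : nat, (0 < k)%nat -> 0 < d -> INR k * a <= d ->
    (a / d) ^ beta <= inv_pow beta k).
  { intros k Hk Hd Hkd. unfold inv_pow. rewrite <- pow_inv.
    assert (0 < INR k) by now apply lt_0_INR.
    apply pow_incr. split; [apply Rdiv_le_0_compat; lra|].
    apply (Rmult_le_reg_r (d * INR k)); [nra|].
    replace (a / d * (d * INR k)) with (INR k * a) by (field; lra).
    replace (/ INR k * (d * INR k)) with d by (field; lra). exact Hkd. }
  split; intros Hd; apply H; try lia; try lra.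
  - rewrite plus_INR, mult_INR. simpl. nra.
  - replace (2 * (n - 1) + 1)%nat with (2 * n - 1)%nat by lia.
    rewrite minus_INR by lia. rewrite mult_INR. simpl. nra.
Qed.

Lemma ratio_pair_le (beta n : nat) (x : R) :
  Rabs x <= 1 / 2 -> x <> 0 -> (0 < n)%nat ->
  (Rabs x / Rabs (x + INR n)) ^ beta + (Rabs x / Rabs (x + - INR n)) ^ beta
  <= odd_inv_pow beta n + odd_inv_pow beta (n - 1).
Proof.
  intros Hx Hx0 Hn.
  assert (H1 : 1 <= INR n) by (apply (le_INR 1); lia).
  assert (Ha : 0 < Rabs x <= 1 / 2) by (split; [now apply Rabs_pos_lt|lra]).
  destruct (ratio_pow_le beta n (Rabs x) (Rabs (x + INR n)) Ha Hn) as [P1 M1].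
  destruct (ratio_pow_le beta n (Rabs x) (Rabs (x + - INR n)) Ha Hn) as [P2 M2].
  destruct (Rcase_abs x) as [Hneg|Hpos].
  - rewrite (Rabs_left x) in * by assumption.
    rewrite (Rabs_pos_eq (x + INR n)) in * by lra.
    rewrite (Rabs_left (x + - INR n)) in * by lra.
    rewrite Rplus_comm.
    apply Rplus_le_compat; [apply P2|apply M1]; lra.
  - rewrite (Rabs_right x) in * by assumption.
    rewrite (Rabs_pos_eq (x + INR n)) in * by lra.
    rewrite (Rabs_left (x + - INR n)) in * by lra.
    apply Rplus_le_compat; [apply P1|apply M2]; lra.
Qed.

(** * Admissible weights *)

Lemma admissible_vanish (beta : nat) (g : R -> R) : admissible_weight beta g ->
  forall z, z <= - (1 / 2) \/ 1 / 2 <= z -> g z = 0.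
Proof.
  intros Hg z Hz.
  destruct (aw_boundary beta g Hg 0) as [Hl Hr]; [lia|]. simpl in Hl, Hr.
  destruct (Req_dec z (- (1 / 2))) as [->|Hzl]; [exact Hl|].
  destruct (Req_dec z (1 / 2)) as [->|Hzr]; [exact Hr|].
  destruct (Req_dec (g z) 0) as [E|E]; [exact E|exfalso].
  assert (Hs : - (1 / 2) <= z <= 1 / 2).
  { apply (aw_support beta g Hg). now apply adherence_P1. }
  lra.
Qed.

Lemma admissible_derive (beta : nat) (g : R -> R) : admissible_weight beta g ->
  forall k, (k < beta - 1)%nat ->
  forall z, is_derive (Derive_n g k) z (Derive_n g (S k) z).
Proof.
  intros Hg k Hk z. apply Derive_correct.
  apply (aw_derivable beta g Hg (S k)). lia.
Qed.

(** Descending induction on the order, from the top derivative, which is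
    bounded by its variation since it vanishes at [1/2].  Going one order
    down, the mean value theorem from [1/2], where every derivative vanishes,
    costs nothing as the interval has length [1]. *)
Lemma admissible_derive_n_le (beta : nat) (g : R -> R) :
  admissible_weight beta g ->
  forall k, (k <= beta - 1)%nat -> forall z, - (1 / 2) <= z <= 1 / 2 ->
  Rabs (Derive_n g (beta - 1 - k) z) <= total_variation (Derive_n g (beta - 1)).
Proof.
  intros Hg. set (V := total_variation _).
  assert (HBV := aw_bounded_variation beta g Hg).
  assert (HV : 0 <= V) by now apply total_variation_pos.
  induction k as [|k IH]; intros Hk z Hz.
  - destruct (aw_boundary beta g Hg (beta - 1)) as [_ H0]; [lia|].
    rewrite Nat.sub_0_r.
    destruct (Req_dec z (1 / 2)) as [->|Hne].
    { rewrite H0, Rabs_R0. exact HV. }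
    assert (H := variation_sum_le (Derive_n g (beta - 1))
                   (fun j => z + INR j * (1 / 2 - z)) 0 HBV).
    rewrite sum_O in H. simpl INR in H.
    replace (z + 1 * (1 / 2 - z)) with (1 / 2) in H by ring.
    replace (z + 0 * (1 / 2 - z)) with z in H by ring.
    rewrite H0, Rminus_0_l, Rabs_Ropp in H. apply H.
    intros j. change (z + INR j * (1 / 2 - z) < z + INR (S j) * (1 / 2 - z)).
    rewrite S_INR. nra.
  - destruct (aw_boundary beta g Hg (beta - 1 - S k)) as [_ H0]; [lia|].
    destruct (mean_value (Derive_n g (beta - 1 - S k))
                (Derive_n g (S (beta - 1 - S k))) z (1 / 2)) as [c [Hc E]].
    { apply (admissible_derive beta g Hg). lia. }
    rewrite Rmin_left, Rmax_right in Hc by lra.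
    rewrite H0, Rminus_0_l in E.
    rewrite <- Rabs_Ropp, E, Rabs_mult, (Rabs_pos_eq (1 / 2 - z)) by lra.
    replace (S (beta - 1 - S k)) with (beta - 1 - k)%nat by lia.
    assert (Hb := IH ltac:(lia) c ltac:(lra)).
    assert (H0' := Rabs_pos (Derive_n g (beta - 1 - k) c)). nra.
Qed.

Lemma admissible_lipschitz (beta : nat) (g : R -> R) : (2 <= beta)%nat ->
  admissible_weight beta g ->
  forall a b, - (1 / 2) <= a <= b -> b <= 1 / 2 ->
  Rabs (g b - g a) <= total_variation (Derive_n g (beta - 1)) * (b - a).
Proof.
  intros Hb Hg a b Ha Hb2.
  destruct (mean_value g (Derive_n g 1) a b) as [c [Hc ->]].
  { apply (admissible_derive beta g Hg 0). lia. }
  rewrite Rmin_left, Rmax_right in Hc by lra.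
  rewrite Rabs_mult, (Rabs_pos_eq (b - a)) by lra.
  apply Rmult_le_compat_r; [lra|].
  assert (E : 1%nat = (beta - 1 - (beta - 2))%nat) by lia.
  rewrite E at 1.
  apply (admissible_derive_n_le beta g Hg); [lia|lra].
Qed.

Lemma admissible_integral (beta : nat) (g : R -> R) : admissible_weight beta g ->
  RInt g (- (1 / 2)) (1 / 2) = 1.
Proof.
  intros Hg.
  assert (Hex : forall a b, ex_RInt g a b).
  { intros a b. apply (ex_RInt_continuous (V := R_CompleteNormedModule)).
    intros z _. apply (aw_continuous beta g Hg). }
  assert (Hz : forall a b, a <= b -> (b <= - (1 / 2) \/ 1 / 2 <= a) ->
    RInt g a b = 0).
  { intros a b Hab Hout.
    rewrite (RInt_ext (V := R_CompleteNormedModule) g (fun _ => 0)).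
    - rewrite RInt_const. apply Rmult_0_r.
    - intros z. rewrite Rmin_left, Rmax_right by lra. intros Hz.
      apply (admissible_vanish beta g Hg). lra. }
  assert (Hab : forall a b, a < - (1 / 2) -> 1 / 2 < b ->
    RInt (fun z => Rabs (g z)) a b = RInt g (- (1 / 2)) (1 / 2)).
  { intros a b Ha Hb.
    rewrite (RInt_ext (V := R_CompleteNormedModule) (fun z => Rabs (g z)) g).
    2:{ intros z _. apply Rabs_pos_eq, (aw_nonneg beta g Hg). }
    rewrite <- (RInt_Chasles g a (- (1 / 2)) b) by apply Hex.
    rewrite <- (RInt_Chasles g (- (1 / 2)) (1 / 2) b) by apply Hex.
    rewrite (Hz a), (Hz _ b) by lra.
    exact (eq_trans (Rplus_0_l _) (Rplus_0_r _)). }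
  set (I := RInt g (- (1 / 2)) (1 / 2)) in *.
  assert (H := aw_normalised beta g Hg). unfold is_RInt_gen in H.
  destruct (Req_dec I 1) as [E|E]; [exact E|exfalso].
  assert (Hd : 0 < Rabs (I - 1)) by (apply Rabs_pos_lt; lra).
  destruct (H (fun y => Rabs (y - 1) < Rabs (I - 1))) as [Q P [m Hm] [p Hp] HQP].
  { exists (mkposreal _ Hd). intros y Hy. exact Hy. }
  (* The improper integral is already attained on any interval containing the
     support, so a limit different from it is contradictory. *)
  set (a := Rmin (m - 1) (-1)). set (b := Rmax (p + 1) 1).
  destruct (HQP a b) as [y [Hy Hy1]].
  - apply Hm. unfold a. generalize (Rmin_l (m - 1) (-1)). lra.
  - apply Hp. unfold b. generalize (Rmax_l (p + 1) 1). lra.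
  - simpl in Hy. apply (is_RInt_unique (V := R_CompleteNormedModule)) in Hy.
    rewrite Hab in Hy.
    + rewrite Hy in Hy1. lra.
    + unfold a. generalize (Rmin_r (m - 1) (-1)). lra.
    + unfold b. generalize (Rmax_r (p + 1) 1). lra.
Qed.

Lemma riemann_sum_error (g : R -> R) (K a h : R) (n : nat) : 0 < h ->
  (forall z, continuous g z) ->
  (forall s t, a <= s <= t -> t <= a + INR (S n) * h ->
    Rabs (g t - g s) <= K * (t - s)) ->
  Rabs (h * sum_n (fun i => g (a + INR i * h)) n
        - RInt g a (a + INR (S n) * h)) <= K * (INR (S n) * h) * h.
Proof.
  intros Hh Hc. 
  assert (Hex : forall a b, ex_RInt g a b).
  { intros s t. apply (ex_RInt_continuous (V := R_CompleteNormedModule)).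
    intros z _. apply Hc. }
  assert (Hone : forall s, (forall t, s <= t <= s + h -> Rabs (g t - g s) <= K * (t - s)) ->
    Rabs (h * g s - RInt g s (s + h)) <= K * h * h).
  { intros s Hs.
    assert (HK : 0 <= K * h).
    { generalize (Hs (s + h) ltac:(lra)) (Rabs_pos (g (s + h) - g s)).
      replace (s + h - s) with h by ring. lra. }
    replace (h * g s - RInt g s (s + h))
      with (- RInt (fun t => g t - g s) s (s + h)).
    - rewrite Rabs_Ropp. eapply Rle_trans.
      + apply (abs_RInt_le_const _ s (s + h) (K * h)); [lra| |].
        * apply (ex_RInt_minus (V := R_NormedModule)); [apply Hex|apply ex_RInt_const].
        * intros t Ht. eapply Rle_trans; [now apply Hs|].
          assert (0 <= K) by nra. apply Rmult_le_compat_l; lra.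
      + apply Req_le. ring.
    - rewrite (RInt_minus (V := R_CompleteNormedModule) g (fun _ => g s));
        [|apply Hex|apply ex_RInt_const].
      rewrite RInt_const. unfold minus, plus, opp, scal; simpl. unfold mult; simpl.
      ring. }
  induction n as [|n IH]; intros HL.
  - rewrite sum_O. simpl INR in *.
    replace (a + 0 * h) with a by ring. replace (a + 1 * h) with (a + h) in * by ring.
    eapply Rle_trans; [apply Hone; intros t Ht; apply HL; lra|]. apply Req_le; ring.
  - rewrite sum_n_S_R.
    set (s := a + INR (S n) * h) in *.
    assert (Hs : a + INR (S (S n)) * h = s + h)
      by (unfold s; rewrite (S_INR (S n)); ring).
    rewrite Hs in *.
    assert (Has : a <= s).
    { unfold s. assert (0 <= INR (S n)) by apply pos_INR. nra. }
    rewrite <- (RInt_Chasles g a s (s + h)) by apply Hex.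
    change plus with Rplus.
    match goal with |- Rabs (h * (?A + ?B) - (?I + ?J)) <= _ =>
      replace (h * (A + B) - (I + J)) with ((h * A - I) + (h * B - J)) by ring end.
    eapply Rle_trans; [apply Rabs_triang|].
    eapply Rle_trans.
    + apply Rplus_le_compat.
      * apply IH. intros u t Hu Ht. apply HL; lra.
      * apply Hone. intros t Ht. apply HL; lra.
    + rewrite (S_INR (S n)). apply Req_le. ring.
Qed.

Definition samples (g : R -> R) (n : nat) (i : nat) : R :=
  g (- (1 / 2) + INR i * / INR n).

Lemma samples_multiple (g : R -> R) (N M : nat) : (0 < N)%nat -> (0 < M)%nat ->
  forall j, samples g (N * M) (j * M) = samples g N j.
Proof.
  intros HN HM j. unfold samples. f_equal. rewrite !mult_INR.
  assert (INR N <> 0) by (apply not_0_INR; lia).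
  assert (INR M <> 0) by (apply not_0_INR; lia). field. tauto.
Qed.

Lemma samples_last (beta : nat) (g : R -> R) (n : nat) :
  admissible_weight beta g -> (0 < n)%nat -> samples g n n = 0.
Proof.
  intros Hg Hn. unfold samples. rewrite Rinv_r by (apply not_0_INR; lia).
  apply (admissible_vanish beta g Hg). lra.
Qed.

Lemma admissible_trig_sum_decay (beta : nat) (g : R -> R) (n : nat) (y : R) :
  (2 <= beta)%nat -> admissible_weight beta g -> (0 < n)%nat ->
  (2 * Rabs (sin (PI * y))) ^ beta * Cmod (trig_sum (samples g n) n y)
  <= / INR n ^ (beta - 1) * total_variation (Derive_n g (beta - 1)).
Proof.
  intros Hb Hg Hn.
  assert (H0 : 0 < INR n) by now apply lt_0_INR.
  assert (Hi : 0 < / INR n) by now apply Rinv_0_lt_compat.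
  rewrite <- pow_inv. replace beta with (S (beta - 1)) at 1 by lia.
  apply (trig_sum_decay (beta - 1) n (Derive_n g) (- (1 / 2)) (/ INR n) y Hi).
  - apply (admissible_derive beta g Hg).
  - apply (aw_bounded_variation beta g Hg).
  - intros z Hz. apply (admissible_vanish beta g Hg). lra.
  - intros z Hz. rewrite Rinv_r in Hz by lra.
    apply (admissible_vanish beta g Hg). lra.
Qed.

(** The Riemann sum of [g] with [n] steps is within [V / n] of [1], as [V] is
    also a Lipschitz constant of [g] on its support. *)
Lemma admissible_sample_sum_ge (beta : nat) (g : R -> R) (n : nat) :
  (2 <= beta)%nat -> admissible_weight beta g -> (0 < n)%nat ->
  INR n - total_variation (Derive_n g (beta - 1)) <= sum_n (samples g n) n.
Proof.
  intros Hb Hg Hn.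
  assert (H0 : 0 < INR n) by now apply lt_0_INR.
  assert (Hi : 0 < / INR n) by now apply Rinv_0_lt_compat.
  assert (Hl := samples_last beta g n Hg Hn).
  destruct n as [|n]; [lia|].
  rewrite sum_n_S_R, Hl, Rplus_0_r.
  assert (H := riemann_sum_error g (total_variation (Derive_n g (beta - 1)))
                 (- (1 / 2)) (/ INR (S n)) n Hi (aw_continuous beta g Hg)).
  rewrite Rinv_r in H by lra.
  replace (- (1 / 2) + 1) with (1 / 2) in H by field.
  rewrite (admissible_integral beta g Hg), Rmult_1_r in H.
  fold (samples g (S n)) in H.
  assert (H1 : Rabs (/ INR (S n) * sum_n (samples g (S n)) n - 1)
     <= total_variation (Derive_n g (beta - 1)) * / INR (S n)).
  { apply H. intros s t Hs Ht. now apply (admissible_lipschitz beta g Hb Hg). }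
  apply Rabs_le_between in H1. destruct H1 as [H1 _].
  apply (Rmult_le_compat_l (INR (S n))) in H1; [|lra].
  set (W := total_variation _) in *. set (Q := sum_n _ _) in *.
  replace (INR (S n) * (/ INR (S n) * Q - 1)) with (Q - INR (S n)) in H1
    by (field; lra).
  replace (INR (S n) * - (W * / INR (S n))) with (- W) in H1 by (field; lra).
  lra.
Qed.

(** * Passing to the limit of infinitely fine sampling *)

Lemma symmetric_sum_minus_centre_le (f : R -> C) (b : nat -> R) (L : nat) :
  (forall n, (1 <= n <= L)%nat -> Cmod (f (INR n)) + Cmod (f (- INR n)) <= b n) ->
  Cmod (Cminus (symmetric_sum f L) (f 0)) <= sum_n_m b 1 L.
Proof.
  intros H. induction L as [|L IH].
  - rewrite symmetric_sum_0, sum_n_m_1_0. apply Req_le.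
    rewrite <- Cmod_0. f_equal. ring_in C.
  - rewrite symmetric_sum_S, sum_n_m_1_S.
    replace (Cminus (Cplus (symmetric_sum f L) (Cplus (f (INR (S L))) (f (- INR (S L))))) (f 0))
      with (Cplus (Cminus (symmetric_sum f L) (f 0)) (Cplus (f (INR (S L))) (f (- INR (S L)))))
      by ring_in C.
    eapply Rle_trans; [apply Cmod_triangle|]. apply Rplus_le_compat.
    + apply IH. intros n Hn. apply H. lia.
    + eapply Rle_trans; [apply Cmod_triangle|]. apply H. lia.
Qed.

Lemma sum_n_m_1_affine (A D : R) (b : nat -> R) (L : nat) :
  sum_n_m (fun n => A * (b n + D)) 1 L = A * (sum_n_m b 1 L + INR L * D).
Proof.
  induction L as [|L IH].
  - rewrite !sum_n_m_1_0. simpl. ring_in R.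
  - rewrite !sum_n_m_1_S, IH, S_INR. ring_in R.
Qed.

(** [2 zeta(beta)] times this number is the bound for the aliased part of the
    sample sum. *)
Definition decay_const (beta : nat) (g : R -> R) (N : nat) : R :=
  total_variation (Derive_n g (beta - 1)) / (INR N ^ (beta - 1) * (2 * PI) ^ beta).

Lemma decay_const_pos (beta : nat) (g : R -> R) (N : nat) :
  admissible_weight beta g -> (0 < N)%nat -> 0 <= decay_const beta g N.
Proof.
  intros Hg HN. apply Rdiv_le_0_compat.
  - apply total_variation_pos, (aw_bounded_variation beta g Hg).
  - generalize PI_RGT_0. intros.
    apply Rmult_lt_0_compat; apply pow_lt; [now apply lt_0_INR|lra].
Qed.

(** The powers of [M] balance: the decay bound has [(N M)^-(beta-1)], the sines
    contribute [M^beta], and one factor [M] is left, which the aliasing identity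
    divides out. *)
Lemma fine_trig_sum_le (beta : nat) (g : R -> R) (N : nat) :
  (2 <= beta)%nat -> admissible_weight beta g -> (0 < N)%nat ->
  exists C, 0 <= C /\ forall q y M, (0 < M)%nat ->
    0 < q <= 1 -> q <= Rabs y -> Rabs y <= INR M / 2 ->
    q ^ beta * Cmod (trig_sum (samples g (N * M)) (N * M) (y / INR M))
    <= INR M * decay_const beta g N * ((q / Rabs y) ^ beta + C / INR M ^ 2).
Proof.
  intros Hb Hg HN. destruct (aliased_term_le beta Hb) as [C [HC Hterm]].
  exists C. split; [exact HC|]. intros q y M HM Hq Hqy HyM.
  assert (HM0 : 0 < INR M) by now apply lt_0_INR.
  assert (HN0 : 0 < INR N) by now apply lt_0_INR.
  specialize (Hterm q y (INR M) Hq Hqy HM0 HyM).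
  assert (Hdec := admissible_trig_sum_decay beta g (N * M) (y / INR M) Hb Hg ltac:(nia)).
  set (T := Cmod _) in *. assert (HT : 0 <= T) by apply Cmod_ge_0.
  rewrite Rpow_mult_distr in Hterm.
  set (s := (2 * Rabs (sin (PI * (y / INR M)))) ^ beta) in *.
  set (V := total_variation _) in *.
  set (X := (q / Rabs y) ^ beta + C / INR M ^ 2) in *.
  assert (HX : 0 <= X).
  { unfold X. apply Rplus_le_le_0_compat.
    - apply pow_le, Rdiv_le_0_compat; lra.
    - apply Rdiv_le_0_compat; [lra|now apply pow_lt]. }
  assert (HP : 0 < / (2 * PI) ^ beta).
  { apply Rinv_0_lt_compat, pow_lt. generalize PI_RGT_0. lra. }
  assert (HMb : 0 < INR M ^ beta) by now apply pow_lt.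
  apply Rle_trans with ((INR M ^ beta * (/ (2 * PI) ^ beta * X)) * (s * T)).
  - apply Rle_trans with (INR M ^ beta * s * (/ (2 * PI) ^ beta * X) * T).
    + now apply Rmult_le_compat_r.
    + apply Req_le. ring.
  - apply Rle_trans with ((INR M ^ beta * (/ (2 * PI) ^ beta * X))
      * (/ INR (N * M) ^ (beta - 1) * V)).
    + apply Rmult_le_compat_l; [|exact Hdec].
      apply Rmult_le_pos; [lra|]. apply Rmult_le_pos; lra.
    + apply Req_le. unfold decay_const. fold V.
      rewrite mult_INR, (Rpow_mult_distr (INR N)).
      replace (INR M ^ beta) with (INR M * INR M ^ (beta - 1))
        by (rewrite tech_pow_Rmult; f_equal; lia).
      assert (0 < INR M ^ (beta - 1)) by now apply pow_lt.
      assert (0 < INR N ^ (beta - 1)) by now apply pow_lt.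
      assert (0 < (2 * PI) ^ beta) by (apply pow_lt; generalize PI_RGT_0; lra).
      field. repeat split; lra.
Qed.

Lemma trig_sum_bound (beta : nat) (g : R -> R) (N : nat) (x : R) :
  (2 <= beta)%nat -> admissible_weight beta g -> (0 < N)%nat ->
  Rabs x <= 1 / 2 -> x <> 0 ->
  Rabs x ^ beta * Cmod (trig_sum (samples g N) N x)
  <= decay_const beta g N * (2 * ((1 - / 2 ^ beta) * zeta beta)).
Proof.
  intros Hb Hg HN Hx Hx0.
  destruct (fine_trig_sum_le beta g N Hb Hg HN) as [C [HC Hfine]].
  set (A := decay_const beta g N) in *.
  assert (HA : 0 <= A) by now apply decay_const_pos.
  assert (Ha : 0 < Rabs x) by now apply Rabs_pos_lt.
  apply (le_of_le_plus_vanishing _ _ (A * C)). intros L.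
  set (M := (2 * L + 1)%nat).
  assert (HM : (0 < M)%nat) by (unfold M; lia).
  assert (HM0 : 0 < INR M) by now apply lt_0_INR.
  assert (HML : INR M = 2 * INR L + 1)
    by (unfold M; rewrite plus_INR, mult_INR; simpl; ring).
  set (f := fun r => trig_sum (samples g (N * M)) (N * M) ((x + r) / INR M)).
  assert (Hal : symmetric_sum f L = Cmult (RtoC (INR M)) (trig_sum (samples g N) N x)).
  { unfold f. rewrite (aliasing _ N M L x eq_refl). f_equal.
    apply sum_n_ext. intros j. rewrite samples_multiple by assumption. reflexivity. }
  set (D := C / INR M ^ 2) in *.
  assert (Hf : forall r, Rabs x <= Rabs (x + r) -> Rabs (x + r) <= INR M / 2 ->
    Cmod (f r) <= / Rabs x ^ beta * (INR M * A * ((Rabs x / Rabs (x + r)) ^ beta + D))).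
  { intros r H1 H2.
    assert (Hpx : 0 < Rabs x ^ beta) by now apply pow_lt.
    apply (Rmult_le_reg_l (Rabs x ^ beta)); [exact Hpx|].
    rewrite <- (Rmult_assoc (Rabs x ^ beta) (/ _)), Rinv_r, Rmult_1_l by lra.
    apply Hfine; try assumption. lra. }
  assert (Hxle := Rabs_le_between x (1 / 2)). destruct Hxle as [Hxle _].
  specialize (Hxle Hx).
  assert (Hc : Cmod (Cminus (symmetric_sum f L) (f 0))
    <= sum_n_m (fun n => / Rabs x ^ beta * (INR M * A) *
         (odd_inv_pow beta n + odd_inv_pow beta (n - 1) + 2 * D)) 1 L).
  { apply symmetric_sum_minus_centre_le. intros n Hn.
    assert (Hn1 : 1 <= INR n) by (apply (le_INR 1); lia).
    assert (HnL : INR n <= INR L) by (apply le_INR; lia).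
    assert (H1 : Rabs x <= Rabs (x + INR n)).
    { rewrite (Rabs_pos_eq (x + INR n)) by lra. lra. }
    assert (H2 : Rabs x <= Rabs (x + - INR n)).
    { rewrite (Rabs_left1 (x + - INR n)) by lra. lra. }
    assert (H3 : Rabs (x + INR n) <= INR M / 2) by (apply Rabs_le; lra).
    assert (H4 : Rabs (x + - INR n) <= INR M / 2) by (apply Rabs_le; lra).
    generalize (Hf (INR n) H1 H3) (Hf (- INR n) H2 H4)
      (ratio_pair_le beta n x Hx Hx0 ltac:(lia)). intros B1 B2 B3.
    eapply Rle_trans; [apply Rplus_le_compat; [exact B1|exact B2]|].
    assert (0 < / Rabs x ^ beta) by (apply Rinv_0_lt_compat, pow_lt; lra).
    assert (0 <= / Rabs x ^ beta * (INR M * A)).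
    { apply Rmult_le_pos; [lra|]. apply Rmult_le_pos; lra. }
    rewrite <- !Rmult_assoc in *. rewrite <- Rmult_plus_distr_l.
    apply Rmult_le_compat_l; [assumption|]. lra. }
  rewrite sum_n_m_1_affine in Hc.
  assert (Hf0 : Cmod (f 0) <= / Rabs x ^ beta * (INR M * A) * (1 + D)).
  { eapply Rle_trans; [apply Hf; rewrite Rplus_0_r; [lra|]|].
    - assert (0 <= INR L) by apply pos_INR. lra.
    - apply Req_le. rewrite Rplus_0_r.
      unfold Rdiv at 1. rewrite Rinv_r, pow1 by lra. ring. }
  assert (Hodd := sum_adjacent_odd_le beta L Hb).
  set (O := sum_n_m _ 1 L) in *.
  set (B := / Rabs x ^ beta * (INR M * A)) in *.
  assert (HB : 0 <= B).
  { apply Rmult_le_pos; [|apply Rmult_le_pos; lra].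
    left. apply Rinv_0_lt_compat, pow_lt. lra. }
  assert (Hs : Cmod (symmetric_sum f L) <= B * (1 + O + INR M * D)).
  { replace (symmetric_sum f L)
      with (Cplus (f 0) (Cminus (symmetric_sum f L) (f 0))) by ring.
    eapply Rle_trans; [apply Cmod_triangle|].
    eapply Rle_trans; [apply Rplus_le_compat; [exact Hf0|exact Hc]|].
    apply Req_le. rewrite HML. ring. }
  rewrite Hal, Cmod_mult, Cmod_R, (Rabs_pos_eq (INR M)) in Hs by lra.
  set (T := Cmod (trig_sum (samples g N) N x)) in *.
  apply (Rmult_le_reg_l (INR M)); [exact HM0|].
  assert (Hpx : 0 < Rabs x ^ beta) by now apply pow_lt.
  apply Rle_trans with (Rabs x ^ beta * (B * (1 + O + INR M * D))).
  { replace (INR M * (Rabs x ^ beta * T)) with (Rabs x ^ beta * (INR M * T)) by ring.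
    apply Rmult_le_compat_l; lra. }
  replace (Rabs x ^ beta * (B * (1 + O + INR M * D)))
    with (INR M * (A * (1 + O) + A * C / INR M)).
  - apply Rmult_le_compat_l; [lra|]. apply Rplus_le_compat_r.
    now apply Rmult_le_compat_l.
  - unfold B, D. field. split; lra.
Qed.

Lemma sample_sum_ge (beta : nat) (g : R -> R) (N : nat) :
  (2 <= beta)%nat -> admissible_weight beta g -> (0 < N)%nat ->
  INR N - decay_const beta g N * (2 * zeta beta) <= sum_n (samples g N) N.
Proof.
  intros Hb Hg HN.
  destruct (fine_trig_sum_le beta g N Hb Hg HN) as [C [HC Hfine]].
  set (A := decay_const beta g N) in *.
  assert (HA : 0 <= A) by now apply decay_const_pos.
  set (V := total_variation (Derive_n g (beta - 1))).
  apply (le_of_le_plus_vanishing _ _ (V + A * C)). intros L.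
  set (M := (2 * L + 1)%nat).
  assert (HM : (0 < M)%nat) by (unfold M; lia).
  assert (HM0 : 0 < INR M) by now apply lt_0_INR.
  assert (HML : INR M = 2 * INR L + 1)
    by (unfold M; rewrite plus_INR, mult_INR; simpl; ring).
  set (f := fun r => trig_sum (samples g (N * M)) (N * M) ((0 + r) / INR M)).
  assert (Hal : symmetric_sum f L = Cmult (RtoC (INR M)) (trig_sum (samples g N) N 0)).
  { unfold f. rewrite (aliasing _ N M L 0 eq_refl). f_equal.
    apply sum_n_ext. intros j. rewrite samples_multiple by assumption. reflexivity. }
  assert (Htr : forall b n, trig_sum b n 0 = RtoC (sum_n b n)).
  { intros b n. unfold trig_sum. induction n as [|n IH].
    - rewrite !sum_O, Rmult_0_r, cis_0. ring.
    - rewrite sum_n_S_C, sum_n_S_R, IH, Rmult_0_r, cis_0, RtoC_plus. ring. }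
  assert (Hf0 : f 0 = RtoC (sum_n (samples g (N * M)) (N * M))).
  { unfold f. replace ((0 + 0) / INR M) with 0 by (field; lra). apply Htr. }
  set (D := C / INR M ^ 2) in *.
  assert (Hc : Cmod (Cminus (symmetric_sum f L) (f 0))
    <= sum_n_m (fun n => 2 * (INR M * A) * (inv_pow beta n + D)) 1 L).
  { apply symmetric_sum_minus_centre_le. intros n Hn.
    assert (Hn1 : 1 <= INR n) by (apply (le_INR 1); lia).
    assert (HnL : INR n <= INR L) by (apply le_INR; lia).
    assert (Hr : forall r, Rabs r = INR n ->
      Cmod (f r) <= INR M * A * (inv_pow beta n + D)).
    { intros r Hr.
      assert (H := Hfine 1 (0 + r) M HM). rewrite Rplus_0_l, Hr in H.
      rewrite pow1, Rmult_1_l in H. unfold Rdiv at 3 in H.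
      rewrite Rmult_1_l, pow_inv in H. fold (inv_pow beta n) D in H.
      unfold f. rewrite Rplus_0_l. apply H; lra. }
    assert (H1 := Hr (INR n) ltac:(apply Rabs_pos_eq; lra)).
    assert (H2 := Hr (- INR n) ltac:(rewrite Rabs_Ropp; apply Rabs_pos_eq; lra)).
    lra. }
  rewrite sum_n_m_1_affine, Hal, Hf0, Htr, <- RtoC_mult, <- RtoC_minus, Cmod_R in Hc.
  assert (Hz := sum_n_m_1_inv_pow_le beta L Hb).
  assert (Hge := admissible_sample_sum_ge beta g (N * M) Hb Hg ltac:(nia)).
  fold V in Hge. rewrite mult_INR in Hge.
  apply Rabs_le_between in Hc. destruct Hc as [Hc _].
  set (S0 := sum_n (samples g N) N) in *.
  set (S1 := sum_n (samples g (N * M)) (N * M)) in *.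
  set (Z := sum_n_m (inv_pow beta) 1 L) in *.
  assert (HMA : 0 <= 2 * (INR M * A)) by nra.
  assert (HD : 0 <= D) by (apply Rdiv_le_0_compat; [lra|now apply pow_lt]).
  assert (H1 : 2 * (INR M * A) * (Z + INR L * D)
    <= INR M * A * (2 * zeta beta) + A * C).
  { apply Rle_trans with (2 * (INR M * A) * zeta beta + (INR M * A) * (INR M * D)).
    - rewrite HML in *. nra.
    - apply Req_le. unfold D. field. lra. }
  apply (Rmult_le_reg_l (INR M)); [exact HM0|].
  replace (INR M * (S0 + (V + A * C) / INR M)) with (INR M * S0 + V + A * C)
    by (field; lra).
  nra.
Qed.

(** * The kernel *)

Lemma sum_int_shift {G : AbelianMonoid} (a : Z) (n : nat) (f : Z -> G) :
  sum_int a (a + Z.of_nat n) f = sum_n (fun j => f (a + Z.of_nat j)%Z) n.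
Proof.
  unfold sum_int.
  replace (Z.to_nat (a + Z.of_nat n - a + 1)) with (S n) by lia.
  rewrite <- sum_n_m_S. apply sum_n_ext. intros j. f_equal. lia.
Qed.

Lemma half_even (H : nat) : half (2 * H) = Z.of_nat H.
Proof.
  unfold half. rewrite Nat2Z.inj_mul, Z.mul_comm. now apply Z.div_mul.
Qed.

Lemma samples_centred (g : R -> R) (H j : nat) : (0 < H)%nat ->
  g (IZR (- Z.of_nat H + Z.of_nat j) / INR (2 * H)) = samples g (2 * H) j.
Proof.
  intros HH. unfold samples. f_equal.
  rewrite plus_IZR, opp_IZR, <- !INR_IZR_INZ, mult_INR. simpl (INR 2).
  field. apply not_0_INR. lia.
Qed.

Lemma sample_norm_eq (g : R -> R) (H : nat) : (0 < H)%nat ->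
  sample_norm g (2 * H) = sum_n (samples g (2 * H)) (2 * H).
Proof.
  intros HH. unfold sample_norm. rewrite half_even.
  replace (Z.of_nat H) with (- Z.of_nat H + Z.of_nat (2 * H))%Z at 2 by lia.
  rewrite sum_int_shift. apply sum_n_ext. intros j. now apply samples_centred.
Qed.

(** Shifting the index in the second half of the damping factor multiplies the
    sum by a phase, so [K_N] is [(c0 + c1) / 2] times the normalised sum of the
    samples, with unimodular [c0] and [c1]. *)
Lemma kernel_le (beta : nat) (g : R -> R) (H : nat) (x : R) :
  admissible_weight beta g -> (0 < H)%nat -> 0 < sample_norm g (2 * H) ->
  Cmod (kernel g (2 * H) x)
  <= Cmod (trig_sum (samples g (2 * H)) (2 * H) x) / sample_norm g (2 * H).
Proof.
  intros Hg HH. set (N := (2 * H)%nat). set (s := sample_norm g N). intros Hs.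
  set (T := trig_sum (samples g N) N x).
  set (c0 := cis (- (2 * PI * INR H * x))).
  set (c1 := cis (- (2 * PI * INR H * x) - 2 * PI * x)).
  assert (Hlast : samples g N N = 0) by (apply (samples_last beta); [assumption|unfold N; lia]).
  assert (Hfirst : samples g N 0 = 0).
  { unfold samples. apply (admissible_vanish beta g Hg). simpl. lra. }
  assert (HK : kernel g N x = Cmult (RtoC (/ (2 * s))) (Cmult (Cplus c0 c1) T)).
  { unfold kernel. unfold N at 1 2. rewrite half_even.
    replace (Z.of_nat H - 1)%Z with (- Z.of_nat H + Z.of_nat (N - 1))%Z by (unfold N; lia).
    rewrite sum_int_shift.
    transitivity (sum_n (fun j => Cmult (RtoC (/ (2 * s)))
      (Cplus (Cmult c0 (Cmult (RtoC (samples g N j)) (cis (2 * PI * INR j * x))))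
             (Cmult c1 (Cmult (RtoC (samples g N (S j))) (cis (2 * PI * INR (S j) * x))))))
      (N - 1)).
    { apply sum_n_ext. intros j. unfold damping. fold s.
      replace (- Z.of_nat H + Z.of_nat j + 1)%Z with (- Z.of_nat H + Z.of_nat (S j))%Z by lia.
      unfold N at 1 2. rewrite !samples_centred by assumption. fold N.
      set (e := cis (2 * PI * IZR (- Z.of_nat H + Z.of_nat j) * x)).
      assert (E0 : Cmult c0 (cis (2 * PI * INR j * x)) = e).
      { unfold c0, e. rewrite <- cis_plus. f_equal.
        rewrite plus_IZR, opp_IZR, <- !INR_IZR_INZ. ring. }
      assert (E1 : Cmult c1 (cis (2 * PI * INR (S j) * x)) = e).
      { unfold c1, e. rewrite <- cis_plus. f_equal.
        rewrite plus_IZR, opp_IZR, <- !INR_IZR_INZ, S_INR. ring. }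
      unfold Rdiv. rewrite RtoC_mult, RtoC_plus.
      transitivity (Cmult (RtoC (/ (2 * s)))
        (Cplus (Cmult (RtoC (samples g N j)) (Cmult c0 (cis (2 * PI * INR j * x))))
               (Cmult (RtoC (samples g N (S j))) (Cmult c1 (cis (2 * PI * INR (S j) * x)))))).
      - rewrite E0, E1. ring_in C.
      - ring_in C. }
    assert (Hgen : forall n,
      sum_n (fun j => Cmult (RtoC (/ (2 * s)))
      (Cplus (Cmult c0 (Cmult (RtoC (samples g N j)) (cis (2 * PI * INR j * x))))
             (Cmult c1 (Cmult (RtoC (samples g N (S j))) (cis (2 * PI * INR (S j) * x))))))
      n = Cmult (RtoC (/ (2 * s)))
           (Cplus (Cmult c0 (trig_sum (samples g N) n x))
                  (Cmult c1 (trig_sum (samples g N) (S n) x)))).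
    { unfold trig_sum. induction n as [|n IH].
      - rewrite sum_n_S_C, !sum_O, Hfirst. ring_in C.
      - rewrite (sum_n_S_C _ (S n)), (sum_n_S_C _ n), IH.
        rewrite (sum_n_S_C _ n).
        ring_in C. }
    rewrite Hgen.
    assert (HT : trig_sum (samples g N) (N - 1) x = T).
    { unfold T. replace N with (S (N - 1)) at 4 by (unfold N; lia).
      unfold trig_sum. rewrite sum_n_S_C.
      replace (S (N - 1)) with N by (unfold N; lia). rewrite Hlast, Cmult_0_l.
      symmetry. apply Cplus_0_r. }
    rewrite HT. replace (S (N - 1)) with N by (unfold N; lia). fold T. ring_in C. }
  rewrite HK, !Cmod_mult, Cmod_R.
  assert (Hi : 0 < / (2 * s)) by (apply Rinv_0_lt_compat; lra).
  rewrite Rabs_pos_eq by lra.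
  assert (Hc : Cmod (Cplus c0 c1) <= 2).
  { eapply Rle_trans; [apply Cmod_triangle|]. unfold c0, c1. rewrite !Cmod_cis. lra. }
  replace (Cmod T / s) with (/ (2 * s) * (2 * Cmod T)) by (field; lra).
  apply Rmult_le_compat_l; [lra|].
  apply Rmult_le_compat_r; [apply Cmod_ge_0|exact Hc].
Qed.

Theorem theorem3p3 :
  forall (beta : nat), (2 <= beta)%nat ->
  forall (g : R -> R), admissible_weight beta g ->
  0 < 2 ^ (beta - 1) * (2 * PI) ^ beta
      - zeta beta * / INR beta ^ beta
        * total_variation (Derive_n g (beta - 1)) ->
  forall (N : nat), Nat.Even N -> (2 * beta <= N)%nat ->
  forall (x : R), - (1 / 2) <= x <= 1 / 2 -> x <> 0 ->
  Cmod (kernel g N x) <=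
    ((2 ^ beta - 1) * zeta beta * total_variation (Derive_n g (beta - 1)))
    / (2 ^ (beta - 1) * (2 * PI) ^ beta
       - zeta beta * / INR beta ^ beta
         * total_variation (Derive_n g (beta - 1)))
    * (1 / (INR N ^ beta * Rabs x ^ beta)).
Proof.
  intros beta Hb g Hg Hden N [H HN] HbN x Hx Hx0.
  assert (HH : (0 < H)%nat) by lia.
  assert (HN0 : (0 < N)%nat) by lia.
  assert (Habs : Rabs x <= 1 / 2) by (apply Rabs_le; lra).
  assert (Hnum := trig_sum_bound beta g N x Hb Hg HN0 Habs Hx0).
  assert (Hnorm := sample_sum_ge beta g N Hb Hg HN0).
  assert (Hker := kernel_le beta g H x Hg HH).
  rewrite <- HN in Hker.
  assert (Hsn : sample_norm g N = sum_n (samples g N) N)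
    by (rewrite HN; now apply sample_norm_eq).
  rewrite <- Hsn in Hnorm.
  assert (HV : 0 <= total_variation (Derive_n g (beta - 1)))
    by apply total_variation_pos, (aw_bounded_variation beta g Hg).
  assert (Hz : 0 <= zeta beta).
  { eapply Rle_trans; [|apply (sum_n_m_1_inv_pow_le beta 0 Hb)].
    rewrite sum_n_m_1_0. lra. }
  unfold decay_const in *.
  set (V := total_variation _) in *. set (Z := zeta beta) in *.
  set (s := sample_norm g N) in *. set (T := Cmod (trig_sum _ _ _)) in *.
  assert (Hn : 0 < INR N) by now apply lt_0_INR.
  assert (Hbe : 0 < INR beta) by (apply lt_0_INR; lia).
  assert (Hpi : 0 < (2 * PI) ^ beta) by (apply pow_lt; generalize PI_RGT_0; lra).
  assert (Hxb : 0 < Rabs x ^ beta) by now apply pow_lt, Rabs_pos_lt.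
  assert (Hn1 : 0 < INR N ^ (beta - 1)) by now apply pow_lt.
  assert (HnS : INR N ^ beta = INR N * INR N ^ (beta - 1))
    by (rewrite tech_pow_Rmult; f_equal; lia).
  assert (H2S : 2 ^ beta = 2 * 2 ^ (beta - 1))
    by (rewrite tech_pow_Rmult; f_equal; lia).
  assert (H21 : 0 < 2 ^ (beta - 1)) by (apply pow_lt; lra).
  assert (Hbb : 0 < INR beta ^ beta) by now apply pow_lt.
  set (P := (2 * PI) ^ beta) in *. set (p := 2 ^ (beta - 1)) in *.
  set (Q := INR N ^ (beta - 1)) in *.
  set (Den := p * P - Z * / INR beta ^ beta * V) in *.
  assert (HNbeta : 2 * p * INR beta ^ beta <= INR N * Q).
  { rewrite <- HnS, <- H2S, <- Rpow_mult_distr. apply pow_incr. split; [lra|].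
    apply le_INR in HbN. rewrite mult_INR in HbN. exact HbN. }
  assert (Hs : INR N * Den <= p * P * s).
  { apply Rle_trans with (p * P * (INR N - V / (Q * P) * (2 * Z))).
    - unfold Den.
      enough (2 * p / Q <= INR N * / INR beta ^ beta) as E.
      { replace (p * P * (INR N - V / (Q * P) * (2 * Z)))
          with (INR N * (p * P) - Z * V * (2 * p / Q)) by (field; split; lra).
        assert (0 <= Z * V) by now apply Rmult_le_pos. nra. }
      apply (Rmult_le_reg_r (Q * INR beta ^ beta)); [nra|].
      replace (2 * p / Q * (Q * INR beta ^ beta)) with (2 * p * INR beta ^ beta)
        by (field; lra).
      replace (INR N * / INR beta ^ beta * (Q * INR beta ^ beta)) with (INR N * Q)
        by (field; lra).
      exact HNbeta.
    - apply Rmult_le_compat_l; [nra|exact Hnorm]. }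
  assert (HpP : 0 < p * P) by now apply Rmult_lt_0_compat.
  assert (Hs0 : 0 < s) by nra.
  specialize (Hker Hs0).
  eapply Rle_trans; [exact Hker|].
  assert (HT : Rabs x ^ beta * T * (p * P * Q) <= (2 ^ beta - 1) * Z * V).
  { apply Rle_trans with (V / (Q * P) * (2 * ((1 - / 2 ^ beta) * Z)) * (p * P * Q)).
    - apply Rmult_le_compat_r; [nra|exact Hnum].
    - apply Req_le. rewrite H2S. field. repeat split; lra. }
  assert (HT0 : 0 <= T) by apply Cmod_ge_0.
  rewrite HnS.
  apply (Rmult_le_reg_r (Den * s * (INR N * Q * Rabs x ^ beta))).
  { repeat apply Rmult_lt_0_compat; assumption. }
  replace (T / s * (Den * s * (INR N * Q * Rabs x ^ beta)))
    with (T * Q * Rabs x ^ beta * (INR N * Den)) by (field; lra).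
  replace (_ * (Den * s * _)) with (((2 ^ beta - 1) * Z * V) * s)
    by (field; repeat split; lra).
  apply Rle_trans with (T * Q * Rabs x ^ beta * (p * P * s)).
  - apply Rmult_le_compat_l; [|exact Hs]. repeat apply Rmult_le_pos; lra.
  - replace (T * Q * Rabs x ^ beta * (p * P * s))
      with (Rabs x ^ beta * T * (p * P * Q) * s) by ring.
    apply Rmult_le_compat_r; lra.
Qed.
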